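(* Let $r\ge 3$. Let $X_{n_1,\dots,n_r}$ be the number of single-unit pills remaining in the urn at the moment when all pills of $r$ units have been taken, in the $r$-type pills urn process started with $n_i$ pills of $i$ units for $i=1,\dots,r$, where $n_1,\dots,n_{r-1}\ge 0$ and $n_r\ge 1$ are integers. Then its probability generating function $h_{n_1,\dots,n_r}(v):=\sum_{k\ge 0}\mathbb{P}\{X_{n_1,\dots,n_r}=k\}\,v^{k}$ is given by $$h_{n_1,\dots,n_r}(v)=n_r\int_{0}^{1}\prod_{j=1}^{r-1}\Bigl(1-(-1)^{j-1}(1-v)\,q\,\frac{\log^{j-1}q}{(j-1)!}\Bigr)^{n_j}\Bigl(1-q-(-1)^{r-1}(1-v)\,q\,\frac{\log^{r-1}q}{(r-1)!}\Bigr)^{n_r-1}dq .$$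
   Context: The $r$-type pills urn process: the urn contains pills of $i$ units for $i=1,\dots,r$; the state is $(n_1,\dots,n_r)$, where $n_i$ is the number of pills of $i$ units. At every step a pill is chosen uniformly at random among the $n_1+\cdots+n_r$ pills. If it is a single-unit pill, it is eaten ($n_1$ decreases by $1$). If it is of $j$ units with $j\ge 2$, it is broken into a part of one unit, which is eaten, and a part of $j-1$ units, which is put back into the urn ($n_j$ decreases by $1$ and $n_{j-1}$ increases by $1$). The process stops as soon as there are no pills of $r$ units in the urn. Equivalently, for $n_1,\dots,n_{r-1}\ge 0$ and $n_r\ge 1$, $$h_{n_1,\dots,n_r}(v)=\frac{n_1}{n_1+\cdots+n_r}h_{n_1-1,n_2,\dots,n_r}(v)+\sum_{j=2}^{r}\frac{n_j}{n_1+\cdots+n_r}h_{n_1,\dots,n_{j-2},n_{j-1}+1,n_j-1,n_{j+1},\dots,n_r}(v),$$ with boundary values $h_{n_1,\dots,n_{r-1},0}(v)=v^{n_1}$. Here $\log^{j-1}q$ means $(\log q)^{j-1}$, with $\log^0 q=1$. The function $h_{n_1,\dots,n_r}$ is a polynomial in $v$, and the claim is an identity of polynomials in $v$. *)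

(* Defs.v *)
From HB Require Import structures.
From mathcomp Require Import all_boot all_order all_algebra.
From mathcomp Require Import all_classical all_reals all_analysis.

Set Implicit Arguments.
Unset Strict Implicit.
Unset Printing Implicit Defensive.
Import Order.TTheory GRing.Theory Num.Theory.
Import numFieldNormedType.Exports.

Local Open Scope classical_set_scope.
Local Open Scope ring_scope.

(* The 0-based component [j : 'I_r] of the state counts the pills of [j.+1]
   units, so that [pills s i] is the number of pills of [i] units for
   [1 <= i <= r]. *)
Definition urn (r : nat) := r.-tuple nat.

Definition pills (r : nat) (s : urn r) (i : nat) : nat := nth 0%N s i.-1.

(* One unit of a pill of [j.+1] units is eaten; the remaining part of [j] units,
   if [0 < j], goes back into the urn. Meaningful if there is such a pill. *)
Definition take_pill (r : nat) (s : urn r) (j : 'I_r) : urn r :=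
  [tuple (tnth s i - (i == j) + (i.+1 == j :> nat))%N | i < r].

(* A uniformly chosen pill has [j.+1] units with probability
   [tnth s j / \sum_i tnth s i]. The chain is frozen once it has stopped. *)
Definition urn_kernel (R : realType) (r : nat) (s t : urn r) : R :=
  if pills s r == 0%N then (t == s)%:R
  else \sum_(j < r | take_pill s j == t)
         (tnth s j)%:R / (\sum_(i < r) tnth s i)%N%:R.

Section process.
Context (d : measure_display) (T : measurableType d) (R : realType).
Variables (P : probability T R) (r : nat).

Definition history (S : nat -> T -> urn r) (s : nat -> urn r) (m : nat) : set T :=
  [set w | forall i, (i <= m)%N -> S i w = s i].

(* The Markov property is in product form, which avoids conditioning on events
   of probability zero. *)
Record pills_urn_process (n : urn r) (S : nat -> {RV P >-> urn r}) : Prop := {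
  urn_init : P (S 0%N @^-1` [set n]) = 1%E ;
  urn_step : forall (m : nat) (s : nat -> urn r),
    P (history S s m.+1) =
      (P (history S s m) * (urn_kernel R (s m) (s m.+1))%:E)%E }.

(* On the (null) event that pills of [r] units never run out, the stopping time
   takes the default value [0]. *)
Definition stopping_time (S : nat -> T -> urn r) (w : T) : nat :=
  xget 0%N [set m | pills (S m w) r = 0%N /\
                    forall i, (i < m)%N -> (0 < pills (S i w) r)%N].

Definition remaining_single_pills (S : nat -> T -> urn r) (w : T) : nat :=
  pills (S (stopping_time S w) w) 1.

Definition pgf_term (X : T -> nat) (v : R) (k : nat) : R :=
  fine (P (X @^-1` [set k])) * v ^+ k.

Definition pgf (X : T -> nat) (v : R) : R := limn (series (pgf_term X v)).

End process.

(* Main.v *)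
Require Import Defs.
From HB Require Import structures.
From mathcomp Require Import all_boot all_order all_algebra.
From mathcomp Require Import all_classical all_reals all_analysis.
From mathcomp Require Import ring lra zify.

Set Implicit Arguments.
Unset Strict Implicit.
Unset Printing Implicit Defensive.
Import Order.TTheory GRing.Theory Num.Theory.
Import numFieldNormedType.Exports.

Local Open Scope classical_set_scope.
Local Open Scope ring_scope.

(** The proof rests on two facts.

    Let [F_i] be the factor of the integrand that belongs to the pills of
    [i.+1] units, and [F_(-1) = 1]. With [q = expR (- t)], [F_i] is the
    generating function at time [t] of a pill that loses its units at rate one,
    a whole pill of [r] units being discarded. This explains the relation
    [q * F_i' = F_i - F_(i-1)] ([is_derive_pill_factor]), which is checked by
    differentiating [q * (- ln q) ^+ k / k`!]. Hence, for a product [M] of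
    powers of the [F_i], the derivative of [q * M] is [M] times the number of
    factors plus one, minus the sum over all factors of the products in which
    [F_i] is replaced by [F_(i-1)] ([is_derive_id_pill_product]). Replacing
    [F_i] by [F_(i-1)] is what taking a pill does to the exponents. The functions
    involved are continuous at [0], so the fundamental theorem of calculus turns
    this into a recursion for the integrals over [[0, 1]]
    ([pill_product_integral_rec]), whose boundary term at [q = 1] supplies the
    value at which the urn process stops. Thus the claimed formula satisfies the
    one-step recursion of the urn ([closed_form_rec]).

    On the other side, every step before stopping eats one unit, so the law of
    the remaining single-unit pills is given by a polynomial [pgf_poly] that is
    computed by the same recursion in finitely many steps
    ([horner_pgf_poly]). That its coefficients are the probabilities follows by
    conditioning on the history of the process, backward in time
    ([prob_history_remaining]): by the product form of the Markov property the
    possible next states carry the whole mass of a history, so that all other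
    continuations are null events. The series of the generating function
    therefore has finitely many nonzero terms and sums to the value of the
    polynomial. *)

(** * The Poisson weights and their derivatives *)

(** For [0 < q <= 1], the probability that a Poisson variable of mean [- ln q]
    takes the value [k]: the chance that a pill of [k.+1] units is down to one
    unit at time [- ln q] when every pill loses its units at rate one. As [ln]
    vanishes on nonpositive numbers, the formula is continuous on the whole
    line. *)
Definition poisson_ln {R : realType} (k : nat) (q : R) : R := q * (- ln q) ^+ k / k`!%:R.

(** With [x = - ln q], the exponential series gives
    [x ^+ k.+1 / k.+1`! <= expR x = q^-1], so the weight is at most
    [k.+1 / x]: this is what makes it vanish as [q] tends to [0]. *)
Lemma poisson_ln_bound (R : realType) (k : nat) (q e : R) :
  0 < e -> 0 < q -> q < expR (- (k.+1%:R / e)) -> `|poisson_ln k q| < e.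
Proof.
move=> e0 q0 qlt; set x := - ln q.
have qE : q = expR (- x) by rewrite /x opprK lnK.
have xgt : k.+1%:R / e < x by move: qlt; rewrite qE ltr_expR ltrN2.
have x0 : 0 < x by apply: lt_trans xgt; rewrite divr_gt0.
have fk0 : 0 < k`!%:R :> R by rewrite ltr0n fact_gt0.
rewrite ger0_norm; last by rewrite /poisson_ln !mulr_ge0 ?exprn_ge0 ?invr_ge0 // ltW.
have := expR_ge1Dxn k (ltW x0); rewrite -lerBrDl.
have -> : expR x = q^-1 by rewrite qE expRN invrK.
move=> hx.
have {}hx : x ^+ k.+1 / k.+1`!%:R <= q^-1 by apply: le_trans hx _; lra.
have {}hx : q * x ^+ k / k`!%:R * x <= k.+1%:R.
  have k0 : k.+1%:R != 0 :> R by rewrite pnatr_eq0.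
  have -> : q * x ^+ k / k`!%:R * x = q * k.+1%:R * (x ^+ k.+1 / k.+1`!%:R).
    rewrite factS natrM exprSr; move: (k.+1%:R) k0 (k`!%:R) fk0 => a a0 b b0.
    by field; rewrite a0 gt_eqF.
  rewrite -[leRHS](mulfK (lt0r_neq0 q0)) [_ * q]mulrC.
  by rewrite ler_wpM2l // mulr_ge0 // ltW.
rewrite /poisson_ln -/x -(ltr_pM2r x0) (le_lt_trans hx) //.
by move: xgt; rewrite ltr_pdivrMr // mulrC.
Qed.

Lemma poisson_ln0E (R : realType) : poisson_ln 0 = id :> (R -> R).
Proof. by apply/funext => x; rewrite /poisson_ln expr0 mulr1 fact0 divr1. Qed.

Lemma poisson_ln_continuous (R : realType) (k : nat) : continuous (@poisson_ln R k).
Proof.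
case: k => [|k] q.
  by rewrite poisson_ln0E; exact: cvg_id.
have [q0|q0|->] := ltgtP q 0.
- have E x : x < 0 -> poisson_ln k.+1 x = 0 :> R.
    by move=> x0; rewrite /poisson_ln ln0 ?ltW// oppr0 expr0n mulr0 mul0r.
  rewrite /continuous_at E //; apply: cvg_near_cst.
  by near=> x; apply: E; near: x; exact: lt_nbhsl.
- rewrite /poisson_ln; apply: cvgM; last exact: cvg_cst.
  apply: cvgM; first exact: cvg_id.
  apply: (@continuous_comp _ _ _ (fun x : R => - ln x) (fun x => x ^+ k.+1)).
    by apply: continuousN; exact: continuous_ln.
  exact: exprn_continuous.
- rewrite /continuous_at; apply/cvgrPdist_lt => e e0.
  have g0 x : x <= 0 -> poisson_ln k.+1 x = 0 :> R.
    by move=> x0; rewrite /poisson_ln ln0 // oppr0 expr0n mulr0 mul0r.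
  rewrite g0 //; near=> x; rewrite sub0r normrN.
  have [x0|x0] := leP x 0; first by rewrite g0 // normr0.
  apply: poisson_ln_bound => //; near: x.
  by apply: lt_nbhsl; exact: expR_gt0.
Unshelve. all: by end_near. Qed.

Lemma is_derive_poisson_ln0 (R : realType) (q : R) : is_derive q 1 (poisson_ln 0) (1 : R).
Proof.
by rewrite poisson_ln0E; exact: is_derive_id.
Qed.

Lemma is_derive_poisson_lnS (R : realType) (k : nat) (q : R) : 0 < q ->
  is_derive q 1 (poisson_ln k.+1) ((poisson_ln k.+1 q - poisson_ln k q) / q).
Proof.
move=> q0.
have dl := is_derive1_ln q0.
have dM := is_deriveM (@is_derive_id _ _ q 1) (is_deriveX k.+1 (is_deriveN dl)).
have dZ := is_deriveZ k.+1`!%:R^-1 dM.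
have -> : poisson_ln k.+1 = (k.+1)`!%:R^-1 \*: (id * (- @ln R) ^+ k.+1).
  by apply/funext => x; rewrite /poisson_ln /= !fctE mulrC.
apply: is_derive_eq dZ _.
rewrite /poisson_ln !fctE /=.
rewrite /GRing.scale /= mulr1 factS natrM exprS.
have a0 : k.+1%:R != 0 :> R by rewrite pnatr_eq0.
have b0 : k`!%:R != 0 :> R by rewrite pnatr_eq0 -lt0n fact_gt0.
move: (k.+1%:R) a0 (k`!%:R) b0 => a a0 b b0.
by field; rewrite a0 b0 gt_eqF.
Qed.

(** * The integrand and its first-order differential relation *)

(** The expectation of [v ^+ [pill is single]] at time [- ln q] for a pill of
    [i.+1] units; when [i.+1 = r] it is restricted to the event that the pill
    is no longer whole, which has probability [1 - q]. *)
Definition pill_factor {R : realType} (v : R) (r i : nat) (q : R) : R :=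
  1 - (i.+1 == r)%:R * q - (1 - v) * poisson_ln i q.

(** An eaten pill contributes the factor [1], which plays the role of index
    [-1] in the relation [q * F_i' = F_i - F_(i-1)]. *)
Definition prev_factor {R : realType} (v : R) (r i : nat) (q : R) : R :=
  if i is i'.+1 then pill_factor v r i' q else 1.

Lemma pill_factor_continuous (R : realType) (v : R) (r i : nat) :
  continuous (pill_factor v r i).
Proof.
move=> q; rewrite /pill_factor; apply: cvgB; [apply: cvgB; first exact: cvg_cst|].
- by apply: cvgM; [exact: cvg_cst|exact: cvg_id].
- by apply: cvgM; [exact: cvg_cst|exact: poisson_ln_continuous].
Qed.

(** The relation [q * F_i' = F_i - F_(i-1)] says that a pill turns into the
    next smaller one at unit rate. It needs [1 < r]: for [r = 1] the term [q]
    of the largest pills would fall on single-unit pills. *)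
Lemma is_derive_pill_factor (R : realType) (v : R) (r i : nat) (q : R) :
  (1 < r)%N -> (i < r)%N -> 0 < q ->
  is_derive q 1 (pill_factor v r i) ((pill_factor v r i q - prev_factor v r i q) / q).
Proof.
move=> r1 ir q0.
have dF dg : is_derive q 1 (poisson_ln i) dg ->
    is_derive q 1 (pill_factor v r i) (- (i.+1 == r)%:R - (1 - v) * dg).
  move=> hg.
  have -> : pill_factor v r i =
      cst 1 - ((i.+1 == r)%:R : R) \*: id - (1 - v) \*: poisson_ln i :> (R -> R).
    by apply/funext => x; rewrite /pill_factor !fctE.
  have h1 := is_deriveB (is_derive_cst (1 : R) q 1)
    (is_deriveZ ((i.+1 == r)%:R : R) (is_derive_id q (1 : R))).
  apply: is_derive_eq (is_deriveB h1 (is_deriveZ (1 - v) hg)) _.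
  by rewrite sub0r /GRing.scale /= mulr1.
case: i ir dF => [|i] ir dF.
- apply: is_derive_eq (dF _ (is_derive_poisson_ln0 q)) _.
  rewrite /pill_factor /= poisson_ln0E (_ : (1 == r)%N = false) /=; last by lia.
  by field; rewrite gt_eqF.
- apply: is_derive_eq (dF _ (is_derive_poisson_lnS i q0)) _.
  rewrite /= /pill_factor (_ : (i.+1 == r)%N = false) /=; last by lia.
  by field; rewrite gt_eqF.
Qed.

Definition pill_product {R : realType} (v : R) (r : nat) (w : urn r) (q : R) : R :=
  \prod_(i < r) pill_factor v r i q ^+ tnth w i.

Lemma pill_product_continuous (R : realType) (v : R) (r : nat) (w : urn r) :
  continuous (pill_product v w).
Proof.
move=> q; rewrite /continuous_at /pill_product; apply: cvg_big => [|i _].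
  exact: mul_continuous.
apply: (@continuous_comp _ _ _ (pill_factor v r i) (fun x => x ^+ tnth w i)).
  exact: pill_factor_continuous.
exact: exprn_continuous.
Qed.

Lemma is_derive_prod (R : realType) (I : eqType) (l : seq I) (f : I -> R -> R)
    (df : I -> R) (x : R) : uniq l ->
  (forall i, i \in l -> is_derive x 1 (f i) (df i)) ->
  is_derive x 1 (fun y => \prod_(i <- l) f i y)
    (\sum_(i <- l) df i * \prod_(j <- l | j != i) f j x).
Proof.
elim: l => [|a l IH] /= => [_ _|/andP[al ul] h].
  under eq_fun do rewrite big_nil.
  by rewrite big_nil; exact: is_derive_cst.
have ha := h a (mem_head _ _).
have {}IH := IH ul (fun i il => h i (mem_behead (s := a :: l) il)).
have -> : (fun y => \prod_(i <- a :: l) f i y) =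
    f a * (fun y => \prod_(i <- l) f i y) :> (R -> R).
  by apply/funext => y; rewrite big_cons.
apply: is_derive_eq (is_deriveM ha IH) _.
rewrite /GRing.scale /= [RHS]big_cons big_cons eqxx /= addrC; congr (_ + _).
  rewrite mulrC; congr (_ * _).
  rewrite [RHS]big_seq_cond [LHS]big_seq.
  by apply: eq_bigl => j; case: (eqVneq j a) => [->|]; rewrite ?(negPf al) ?andbT.
rewrite mulr_sumr; apply: eq_big_seq => i il.
rewrite big_cons; case: (eqVneq a i) => [E|_]; first by rewrite E il in al.
by rewrite mulrCA.
Qed.

(** Taking a pill of type [i] divides the product by [F_i] and multiplies it by
    [F_(i-1)]; the exponent [.-1] avoids the division, as [F_i] may vanish. *)
Lemma pill_product_take_pill (R : realType) (v : R) (r : nat) (w : urn r) (i : 'I_r) (q : R) :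
  (0 < tnth w i)%N ->
  pill_product v (take_pill w i) q = prev_factor v r i q * pill_factor v r i q ^+ (tnth w i).-1 *
    \prod_(j < r | j != i) pill_factor v r j q ^+ tnth w j.
Proof.
move=> wi; rewrite /pill_product.
under eq_bigr do rewrite tnth_mktuple exprD.
rewrite big_split /= [X in X * _](bigD1 i) //= eqxx subn1 mulrC -mulrA.
congr (_ * (_ * _)).
  case: i wi => -[|i] ir _ /=; first by rewrite big1.
  have ir' : (i < r)%N by apply: ltnW.
  rewrite (bigD1 (Ordinal ir')) //= eqxx expr1 big1 ?mulr1 // => j.
  rewrite -val_eqE /= => /negPf ji; by rewrite eqSS ji.
by apply: eq_bigr => j /negPf ->; rewrite subn0.
Qed.

(** By the Leibniz rule and [q * F_i' = F_i - F_(i-1)], the operator [q * d/dq]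
    acts on pill products as the urn does: each pill contributes the product
    itself minus the product after it has been taken. The additional [1] comes
    from differentiating the factor [q]. *)
Lemma is_derive_id_pill_product (R : realType) (v : R) (r : nat) (w : urn r) (q : R) :
  (1 < r)%N -> 0 < q ->
  is_derive q 1 (fun x => x * pill_product v w x)
    ((1 + \sum_(i < r) tnth w i)%N%:R * pill_product v w q -
     \sum_(i < r) (tnth w i)%:R * pill_product v (take_pill w i) q).
Proof.
move=> r1 q0.
have dpow (i : 'I_r) : i \in index_enum 'I_r ->
    is_derive q 1 (fun x => pill_factor v r i x ^+ tnth w i)
      ((tnth w i)%:R * pill_factor v r i q ^+ (tnth w i).-1 *
       ((pill_factor v r i q - prev_factor v r i q) / q)).
  move=> _; have := is_deriveX (tnth w i) (is_derive_pill_factor v r1 (ltn_ord i) q0).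
  by rewrite exprfctE.
have dM := is_deriveM (is_derive_id q (1 : R)) (is_derive_prod (index_enum_uniq _) dpow).
apply: is_derive_eq dM _.
rewrite /GRing.scale /= mulr1 addrC natrD mulrDl mul1r -addrA; congr (_ + _).
rewrite natr_sum mulr_suml mulr_sumr -sumrB; apply: eq_bigr => i _.
case: (posnP (tnth w i)) => [->|wi]; first by rewrite !mul0r subr0 mulr0.
rewrite pill_product_take_pill // /pill_product [X in _ = _ * X - _](bigD1 i) //=.
rewrite -{4}(prednK wi) exprS.
move: (\prod_(_ < r | _) _) => p; field.
by rewrite gt_eqF.
Qed.

(** * The recursion for the integrals *)

Definition pill_product_integral {R : realType} (v : R) (r : nat) (w : urn r) : R :=
  \int[lebesgue_measure]_(q in `[0%R, 1%R]) pill_product v w q.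

Lemma pill_product_integrable (R : realType) (v : R) (r : nat) (w : urn r) :
  (@lebesgue_measure R).-integrable `[0%R, 1%R] (EFin \o pill_product v w).
Proof.
apply: continuous_compact_integrable; first exact: segment_compact.
by apply: continuous_subspaceT; exact: pill_product_continuous.
Qed.

Lemma EFin_pill_product_integral (R : realType) (v : R) (r : nat) (w : urn r) :
  (pill_product_integral v w)%:E =
  (\int[lebesgue_measure]_(q in `[0%R, 1%R]) (pill_product v w q)%:E)%E.
Proof.
rewrite /pill_product_integral /Rintegral fineK //.
by apply: integrable_fin_num => //; exact: pill_product_integrable.
Qed.

(** The derivative of [q * pill_product v w q] integrated over [[0, 1]]; the boundary term at [0]
    vanishes because of the factor [q]. The additional [1] on the left counts the
    pill whose splitting ends the process. *)
Lemma pill_product_integral_rec (R : realType) (v : R) (r : nat) (w : urn r) :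
  (1 < r)%N ->
  (1 + \sum_(i < r) tnth w i)%N%:R * pill_product_integral v w =
  \sum_(i < r) (tnth w i)%:R * pill_product_integral v (take_pill w i) + pill_product v w 1.
Proof.
move=> r1.
set N := (1 + _)%N%:R.
pose g (x : R) := N * pill_product v w x -
  \sum_(i < r) (tnth w i)%:R * pill_product v (take_pill w i) x.
have cM : continuous (fun x : R => x * pill_product v w x).
  by move=> x; apply: cvgM; [exact: cvg_id|exact: pill_product_continuous].
have cg : continuous g.
  move=> x; rewrite /continuous_at /g; apply: cvgB.
    by apply: cvgM; [exact: cvg_cst|exact: pill_product_continuous].
  apply: cvg_big => [|i _]; first exact: add_continuous.
  by apply: cvgM; [exact: cvg_cst|exact: pill_product_continuous].
have dM (x : R) : x \in `]0, 1[%R -> is_derive x 1 (fun x => x * pill_product v w x) (g x).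
  by rewrite in_itv /= => /andP[x0 _]; exact: is_derive_id_pill_product.
have : (\int[lebesgue_measure]_(q in `[0%R, 1%R]) (g q)%:E = (pill_product v w 1)%:E)%E.
  rewrite (continuous_FTC2 (F := fun x => x * pill_product v w x)) //.
  - by rewrite mul1r mul0r sube0.
  - exact: continuous_subspaceT.
  - split=> [x xin||].
    + by case: (dM x xin).
    + by apply: cvg_at_right_filter; exact: cM.
    + by apply: cvg_at_left_filter; exact: cM.
  - by move=> x xin; rewrite derive1E; case: (dM x xin).
have mI : measurable (`[0%R, 1%R]%classic : set R) by [].
have iZ (c : R) (w' : urn r) : (@lebesgue_measure R).-integrable `[0%R, 1%R]
    (fun x => (c * pill_product v w' x)%:E).
  exact: integrableZl (pill_product_integrable v w').
have IZ (c : R) (w' : urn r) :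
    (\int[lebesgue_measure]_(x in `[0%R, 1%R]) (c * pill_product v w' x)%:E =
    (c * pill_product_integral v w')%:E)%E.
  under eq_integral do rewrite EFinM.
  rewrite integralZl //; last exact: pill_product_integrable.
  by rewrite EFinM EFin_pill_product_integral.
under eq_integral do rewrite /g EFinB -sumEFin.
rewrite integralB //=; last exact: integrable_sum.
rewrite IZ integral_sum //; rewrite (eq_bigr _ (fun i _ => IZ _ _)).
by rewrite sumEFin -EFinB => -[<-]; rewrite addrC subrK.
Qed.

Lemma tnth_pills (r : nat) (n : urn r) (i : 'I_r) : tnth n i = pills n i.+1.
Proof. by rewrite /pills (tnth_nth 0%N). Qed.

Lemma pill_factor_at1 (R : realType) (v : R) (r i : nat) : (1 < r)%N ->
  pill_factor v r i 1 = if i == 0%N then v else (i.+1 != r)%:R.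
Proof.
move=> r1; rewrite /pill_factor /poisson_ln ln1 oppr0 expr0n !mul1r mulr1.
have [->|_] := eqVneq i 0%N.
  rewrite fact0 divr1 mulr1 (_ : (1 == r)%N = false); last by lia.
  by rewrite subr0 subKr.
by rewrite mul0r mulr0 subr0; case: eqP => _; rewrite ?subrr ?subr0.
Qed.

(** At [q = 1], that is at time [0], a single-unit pill has factor [v], an
    intermediate pill [1], and a whole pill of [r] units [0]. *)
Lemma pill_product_at1 (R : realType) (v : R) (r : nat) (w : urn r) : (1 < r)%N ->
  pill_product v w 1 = if pills w r == 0%N then v ^+ pills w 1 else 0.
Proof.
case: r w => [//|r] w r1; rewrite /pill_product.
have Lmax : pills w r.+1 = tnth w ord_max by rewrite tnth_pills.
rewrite Lmax; case: eqP => [w0|/eqP w0].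
  rewrite (bigD1 ord0) //= big1 => [|i i0].
    by rewrite pill_factor_at1 //= mulr1 tnth_pills.
  rewrite pill_factor_at1 // (negPf (i0 : val i != 0%N)).
  have [->|iL] := eqVneq i ord_max; first by rewrite w0.
  have -> : i.+1 != r.+1 by rewrite eqSS; exact: iL.
  by rewrite expr1n.
rewrite (bigD1 ord_max) //= pill_factor_at1 //= eqxx.
have -> : (r == 0)%N = false by lia.
by rewrite expr0n (negPf w0) mul0r.
Qed.

(** The exponents of the integrand: the pill of [r] units that is broken last
    is set apart, its breaking time having density [expR (- t)], that is [dq]
    in the variable [q = expR (- t)]. *)
Definition remove_large_pill (r : nat) (n : urn r) : urn r :=
  [tuple (tnth n i - (i.+1 == r :> nat))%N | i < r].

Lemma remove_large_pill_take_pill (r : nat) (n : urn r) (j : 'I_r) :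
  remove_large_pill (take_pill n j) = take_pill (remove_large_pill n) j.
Proof.
apply: eq_from_tnth => i; rewrite !tnth_mktuple.
by have := ltn_ord j; have := ltn_ord i; case: (i =P j) => [->|_]; lia.
Qed.

Definition closed_form {R : realType} (v : R) (r : nat) (n : urn r) : R :=
  if pills n r == 0%N then v ^+ pills n 1
  else (pills n r)%:R * pill_product_integral v (remove_large_pill n).

(** The recursion for the integrals, multiplied by [pills n r]. If the pill that
    is taken is of [r] units, either other ones remain and the boundary term at
    [q = 1] is zero, or it was the last one, its coefficient
    [pills n r - 1] in the recursion is zero, and the boundary term is the value
    [v ^+ pills n 1] at which the process stops. That value is not affected by
    the last step because [2 < r]. *)
Lemma closed_form_rec (R : realType) (v : R) (r : nat) (n : urn r) :
  (2 < r)%N -> (0 < pills n r)%N ->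
  (\sum_(i < r) tnth n i)%N%:R * closed_form v n =
  \sum_(j < r) (tnth n j)%:R * closed_form v (take_pill n j).
Proof.
case: r n => [//|r] n r2 n0.
rewrite {1}/closed_form gtn_eqF //; set w := remove_large_pill n.
have Lmax (a : urn r.+1) : pills a r.+1 = tnth a ord_max by rewrite tnth_pills.
have wL : tnth w ord_max = (pills n r.+1).-1.
  by rewrite tnth_mktuple -Lmax /= eqxx subn1.
have wE (i : 'I_r.+1) : i != ord_max -> tnth w i = tnth n i.
  by move=> iL; rewrite tnth_mktuple eqSS (negPf (iL : val i != r)) subn0.
have -> : (\sum_(i < r.+1) tnth n i = 1 + \sum_(i < r.+1) tnth w i)%N.
  rewrite (bigD1 ord_max) //= [in RHS](bigD1 ord_max) //= wL -Lmax addnA add1n.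
  by rewrite prednK //; congr addn; apply: eq_bigr => i /wE.
rewrite mulrCA pill_product_integral_rec; last by lia.
rewrite (bigD1 ord_max) //= [RHS](bigD1 ord_max) //= [X in _ * X]addrAC mulrDr.
congr (_ + _); last first.
  rewrite mulr_sumr; apply: eq_bigr => j jL; rewrite wE //.
  have E : pills (take_pill n j) r.+1 = pills n r.+1.
    rewrite !Lmax tnth_mktuple eq_sym (negPf jL) subn0 /=.
    by rewrite gtn_eqF ?addn0 // ltnW.
  by rewrite /closed_form E gtn_eqF // remove_large_pill_take_pill mulrCA.
rewrite -Lmax -[in RHS]Lmax; congr (_ * _).
have E : pills (take_pill n ord_max) r.+1 = (pills n r.+1).-1.
  by rewrite !Lmax tnth_mktuple eqxx subn1 /= gtn_eqF ?addn0.
rewrite /closed_form E pill_product_at1; last by lia.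
rewrite (Lmax w) wL remove_large_pill_take_pill.
case: eqP => [->|_]; last by rewrite addr0.
rewrite mul0r add0r.
have -> : pills w 1 = pills n 1.
  by rewrite -[1%N]/(val (@ord0 r)).+1 -!tnth_pills wE // -val_eqE /=; lia.
rewrite -[1%N]/(val (@ord0 r)).+1 -!tnth_pills tnth_mktuple -val_eqE /=.
have [-> ->] : (0 == r)%N = false /\ (1 == r)%N = false by lia.
by rewrite subn0 addn0.
Qed.

(** * The generating polynomial of the process *)

Definition units (r : nat) (a : urn r) : nat := \sum_(i < r) i.+1 * tnth a i.

Lemma units_take_pill (r : nat) (a : urn r) (j : 'I_r) :
  (0 < tnth a j)%N -> (units (take_pill a j) < units a)%N.
Proof.
move=> aj; rewrite /units.
under eq_bigr do rewrite tnth_mktuple mulnDr.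
rewrite big_split /= [X in (X + _ < _)%N](bigD1 j) //= eqxx [X in (_ < X)%N](bigD1 j) //=.
have -> : (\sum_(i < r) i.+1 * (i.+1 == j) = j)%N.
  case: j {aj} => -[|j] jr /=; first by rewrite big1 // => i _; rewrite muln0.
  rewrite (bigD1 (Ordinal (ltnW jr))) //= eqxx muln1 big1 ?addn0 // => i.
  by rewrite -val_eqE /= eqSS => /negPf ->; rewrite muln0.
under eq_bigr => i /negPf -> do rewrite subn0.
rewrite mulnBr; have : (j.+1 <= j.+1 * tnth a j)%N by rewrite leq_pmulr.
by lia.
Qed.

(** First-step analysis. The argument [u] bounds the number of steps and makes
    the recursion structural; the total number of units is always enough. *)
Fixpoint pgf_poly (R : realType) (r u : nat) (a : urn r) : {poly R} :=
  if pills a r == 0%N then 'X^(pills a 1)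
  else if u is u'.+1 then
    \sum_(j < r) ((tnth a j)%:R / (\sum_(i < r) tnth a i)%N%:R) *:
      pgf_poly R u' (take_pill a j)
  else 0.

Lemma last_pills_gt0 (r : nat) (a : urn r) : (0 < r)%N -> (0 < pills a r)%N ->
  exists j : 'I_r, (0 < tnth a j)%N.
Proof. by case: r a => // r a _ h; exists ord_max; rewrite tnth_pills. Qed.

Lemma units_gt0 (r : nat) (a : urn r) : (0 < r)%N -> (0 < pills a r)%N ->
  (0 < units a)%N.
Proof.
move=> r0 h; have [j aj] := last_pills_gt0 r0 h.
exact: leq_ltn_trans (units_take_pill aj).
Qed.

Lemma total_gt0 (r : nat) (a : urn r) : (0 < r)%N -> (0 < pills a r)%N ->
  (0 < \sum_(i < r) tnth a i)%N.
Proof.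
move=> r0 h; have [j aj] := last_pills_gt0 r0 h.
by rewrite (bigD1 j) //= addn_gt0 aj.
Qed.

Lemma horner_pgf_poly (R : realType) (v : R) (r u : nat) (a : urn r) :
  (2 < r)%N -> (units a <= u)%N -> (pgf_poly R u a).[v] = closed_form v a.
Proof.
move=> r2; have r0 : (0 < r)%N by lia.
elim: u a => [|u IH] a au /=.
all: have [a0|a0] := eqVneq (pills a r) 0%N; first by rewrite hornerXn /closed_form a0.
all: rewrite -lt0n in a0.
  by have := units_gt0 r0 a0; lia.
have t0 : (\sum_(i < r) tnth a i)%N%:R != 0 :> R.
  by rewrite pnatr_eq0 -lt0n total_gt0.
apply: (mulfI t0); rewrite closed_form_rec // horner_sum mulr_sumr.
apply: eq_bigr => j _; rewrite hornerZ.
have [->|aj] := posnP (tnth a j); first by rewrite !mul0r mulr0.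
rewrite IH; last by have := units_take_pill aj; lia.
by rewrite mulrA mulrCA divff // mulr1.
Qed.

(** * The process *)

Lemma measurable_tuple_nat (r : nat) (A : set (r.-tuple nat)) : measurable A.
Proof.
apply: countable_measurable => [t|]; last exact: countableP.
have -> : [set t] = \big[setI/setT]_(i < r)
    ((fun s : r.-tuple nat => tnth s i) @^-1` [set tnth t i]).
  rewrite -bigcap_seq; apply/seteqP; split => [s -> //|s h].
  apply: eq_from_tnth => i.
  by apply: (h i); rewrite /= mem_index_enum.
apply: bigsetI_measurable => i _.
by rewrite -[X in measurable X]setTI; apply: measurable_tnth.
Qed.

(** With [undup], nothing has to be known about moves that lead to the same
    state. Only pills that are present are taken, so that every listed state has
    fewer units than [a]. *)
Lemma sum_urn_kernel (R : realType) (r : nat) (a : urn r) (g : urn r -> R) :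
  pills a r != 0%N ->
  \sum_(t <- undup [seq take_pill a j | j <- enum 'I_r & (0 < tnth a j)%N])
     urn_kernel R a t * g t =
  \sum_(j < r) (tnth a j)%:R / (\sum_(i < r) tnth a i)%N%:R * g (take_pill a j).
Proof.
move=> a0; rewrite /urn_kernel (negPf a0); move: (\sum_i _)%N => N; set l := undup _.
under eq_bigr do rewrite mulr_suml big_mkcond.
rewrite exchange_big; apply: eq_bigr => j _ /=.
have [->|aj] := posnP (tnth a j).
  by rewrite !mul0r big1 // => t _; case: ifP; rewrite // !mul0r.
rewrite (bigD1_seq (take_pill a j)) ?undup_uniq //=; last first.
  by rewrite mem_undup; apply: map_f; rewrite mem_filter aj mem_enum.
rewrite eqxx big1 ?addr0 // => t /negPf.
by rewrite eq_sym => ->.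
Qed.

Lemma measure_split (d : measure_display) (T : measurableType d) (R : realType)
    (P : probability T R) (I : eqType) (f : T -> I) (A : set T) (l : seq I) :
  (forall B, measurable (f @^-1` B)) -> measurable A -> uniq l ->
  P A = (\sum_(t <- l) P (A `&` f @^-1` [set t]) +
         P (A `&` f @^-1` [set t | t \notin l]))%E.
Proof.
move=> mf mA; elim: l => [_|a l IH /= /andP[al ul]].
  rewrite big_nil add0e; congr (P _); apply/seteqP; split => x //= [].
  by [].
rewrite big_cons {}IH // -addeA addeCA; congr (_ + _)%E; rewrite -measureU.
- congr (P _); apply/seteqP; split => x /=.
  + move=> [Ax xl]; rewrite in_cons negb_or.
    by have [<-|xa] := eqVneq (f x) a; [left|right].
  + by rewrite in_cons negb_or => -[[Ax ->]|[Ax /andP[]]].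
- by apply: measurableI => //; exact: mf.
- by apply: measurableI => //; exact: mf.
- apply/seteqP; split => x //= [[_ ->]].
  by rewrite mem_head => -[].
Qed.

Section Process.
Context (d : measure_display) (T : measurableType d) (R : realType).
Variables (P : probability T R) (r : nat) (S : nat -> T -> urn r).
Hypothesis mS : forall m (A : set (urn r)), measurable (S m @^-1` A).

Definition stops_at (m : nat) : set T :=
  [set w | pills (S m w) r = 0%N /\ forall i, (i < m)%N -> (0 < pills (S i w) r)%N].

Lemma stopping_time_at (m : nat) (w : T) : stops_at m w -> stopping_time S w = m.
Proof.
move=> hm; apply: xget_unique => // m' [h0 h1]; case: hm => k0 k1.
case: (ltngtP m' m) => // lt; first by have := k1 _ lt; rewrite h0.
by have := h1 _ lt; rewrite k0.
Qed.

Lemma measurable_stops_at (m : nat) : measurable (stops_at m).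
Proof.
have -> : stops_at m = S m @^-1` [set a | pills a r = 0%N] `&`
    \bigcap_(i in [set i | (i < m)%N]) (S i @^-1` [set a | (0 < pills a r)%N]).
  by apply/seteqP; split => w [].
by apply: measurableI => //; apply: bigcap_measurableType => // i _.
Qed.

(** The default value of the stopping time, on the paths that never stop, has to
    be treated apart. *)
Lemma measurable_remaining (k : nat) :
  measurable (remaining_single_pills S @^-1` [set k]).
Proof.
have -> : remaining_single_pills S @^-1` [set k] =
    (\bigcup_m (stops_at m `&` S m @^-1` [set a | pills a 1 = k])) `|`
    (~` (\bigcup_m stops_at m) `&` S 0%N @^-1` [set a | pills a 1 = k]).
  apply/seteqP; split => w /=.
    rewrite /remaining_single_pills => wk.
    have [[m _ hm]|hn] := pselect ((\bigcup_m stops_at m) w).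
      by left; exists m => //; split => //=; rewrite -(stopping_time_at hm).
    right; split=> //; move: wk; rewrite /stopping_time xgetPN // => m hm.
    by apply: hn; exists m.
  case=> [[m _ [hm /= <-]]|[hn <-]]; rewrite /remaining_single_pills.
    by rewrite (stopping_time_at hm).
  rewrite /stopping_time xgetPN // => m hm.
  by apply: hn; exists m.
apply: measurableU.
  apply: bigcupT_measurable => m; apply: measurableI => //.
  exact: measurable_stops_at.
apply: measurableI => //; apply: measurableC; apply: bigcupT_measurable => m.
exact: measurable_stops_at.
Qed.

Lemma measurable_history (s : nat -> urn r) (m : nat) : measurable (history S s m).
Proof.
have -> : history S s m =
    \bigcap_(i in [set i | (i <= m)%N]) (S i @^-1` [set s i]) by [].
by apply: bigcap_measurableType => i _; exact: mS.
Qed.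

Lemma prob_history_stopped (m k : nat) (s : nat -> urn r) :
  pills (s m) r = 0%N -> (forall i, (i < m)%N -> (0 < pills (s i) r)%N) ->
  (P (history S s m `&` remaining_single_pills S @^-1` [set k]) =
   P (history S s m) * (('X^(pills (s m) 1) : {poly R})`_k)%:E)%E.
Proof.
move=> sm0 hs.
have XE w : history S s m w -> remaining_single_pills S w = pills (s m) 1.
  move=> hw; rewrite /remaining_single_pills (@stopping_time_at m) ?hw //.
  by split=> [|i im]; rewrite hw //; [exact: hs|exact: ltnW].
rewrite coefXn; have [->|kp] := eqVneq k (pills (s m) 1%N).
  by rewrite mule1; congr (P _); apply/setIidPl => w /XE.
rewrite mule0 (_ : _ `&` _ = set0) ?measure0 //.
by apply/seteqP; split => // w [/XE wE /= wk]; rewrite -wE wk eqxx in kp.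
Qed.

Hypothesis S_step : forall (m : nat) (s : nat -> urn r),
  (P (history S s m.+1) = P (history S s m) * (urn_kernel R (s m) (s m.+1))%:E)%E.

(** Given any history that has not yet stopped before time [m], the number of
    remaining single-unit pills is distributed according to the generating
    polynomial of the state at time [m]. The induction is backward in time, on
    the units left: the histories of length [m.+1] that extend the given one by a
    possible move split it up to a null event, because the probabilities of
    these moves sum to one. *)
Lemma prob_history_remaining (u m k : nat) (s : nat -> urn r) :
  (0 < r)%N -> (units (s m) <= u)%N ->
  (forall i, (i < m)%N -> (0 < pills (s i) r)%N) ->
  (P (history S s m `&` remaining_single_pills S @^-1` [set k]) =
   P (history S s m) * ((pgf_poly R u (s m))`_k)%:E)%E.
Proof.
move=> r0; elim: u m s => [|u IH] m s au hs /=.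
all: have [a0|a0] := eqVneq (pills (s m) r) 0%N; first exact: prob_history_stopped.
  by rewrite -lt0n in a0; have := units_gt0 r0 a0; lia.
set H := history S s m; set E := remaining_single_pills S @^-1` [set k].
set a := s m; set l := undup [seq take_pill a j | j <- enum 'I_r & (0 < tnth a j)%N].
have ul : uniq l by exact: undup_uniq.
have mH : measurable H := measurable_history s m.
have mE : measurable E := measurable_remaining k.
pose ext t i := if (i <= m)%N then s i else t.
have extm t : ext t m = a by rewrite /ext leqnn.
have extS t : ext t m.+1 = t by rewrite /ext ltnn.
have hext t : history S (ext t) m = H.
  by apply/seteqP; split => w hw i im; have := hw i im; rewrite /ext im.
have hextS t : history S (ext t) m.+1 = H `&` S m.+1 @^-1` [set t].
  apply/seteqP; split => w.
    move=> hw; split; last by have := hw m.+1 (leqnn _); rewrite extS.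
    by move=> i im; have := hw i (leqW im); rewrite /ext im.
  move=> [hw wt] i; rewrite leq_eqVlt ltnS => /orP[/eqP->|im]; first by rewrite extS.
  by rewrite /ext im; exact: hw.
have [x Hx] : exists x, P H = x%:E.
  by exists (fine (P H)); rewrite fineK // fin_num_measure.
have PHt t : P (H `&` S m.+1 @^-1` [set t]) = (x * urn_kernel R a t)%:E.
  by rewrite -hextS S_step extm extS hext Hx EFinM.
(* The moves of [l] exhaust the mass of [H], so the other ones are null. *)
have rest0 : P (H `&` S m.+1 @^-1` [set t | t \notin l]) = 0%E.
  have := measure_split P (mS m.+1) mH ul.
  under eq_bigr do rewrite PHt -[urn_kernel _ _ _]mulr1.
  rewrite sumEFin -mulr_sumr (sum_urn_kernel (fun=> 1)) // -mulr_suml mulr1.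
  rewrite -mulr_suml -natr_sum divff; last first.
    by rewrite pnatr_eq0 -lt0n total_gt0 // lt0n.
  have mF : measurable (H `&` S m.+1 @^-1` [set t | t \notin l]).
    exact: measurableI.
  rewrite mulr1 Hx.
  have : P (H `&` S m.+1 @^-1` [set t | t \notin l]) \is a fin_num.
    exact: fin_num_measure.
  by case: (P _) => // y _; rewrite -EFinD => -[xE]; congr (_%:E); lra.
rewrite (measure_split P (mS m.+1) (measurableI _ _ mH mE) ul).
rewrite (_ : P (_ `&` _ `&` _ @^-1` [set t | t \notin l]) = 0%E); last first.
  apply: subset_measure0 rest0.
  - by apply: measurableI => //; exact: measurableI.
  - exact: measurableI.
  - by move=> w [[]].
rewrite adde0.
rewrite (eq_big_seq (fun t => (x * (urn_kernel R a t * (pgf_poly R u t)`_k))%:E)).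
  rewrite sumEFin -mulr_sumr (sum_urn_kernel (fun t => (pgf_poly R u t)`_k)) //.
  rewrite Hx -EFinM coef_sum; congr (_ * _)%:E.
  by apply: eq_bigr => j _; rewrite coefZ.
move=> t; rewrite mem_undup => /mapP[j]; rewrite mem_filter => /andP[aj _] tE.
rewrite setIAC -hextS IH.
- by rewrite hextS PHt extS -EFinM mulrA.
- by rewrite extS tE; have := units_take_pill aj; rewrite -/a in au; lia.
- move=> i; rewrite ltnS leq_eqVlt => /orP[/eqP->|im].
    by rewrite extm lt0n.
  by rewrite /ext (ltnW im); exact: hs.
Qed.

Lemma pgf_term_remaining (n : urn r) (v : R) (k : nat) : (0 < r)%N ->
  P (S 0%N @^-1` [set n]) = 1%E ->
  pgf_term P (remaining_single_pills S) v k = (pgf_poly R (units n) n)`_k * v ^+ k.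
Proof.
move=> r0 Pn; rewrite /pgf_term; congr (_ * _).
have H0 : history S (fun=> n) 0 = S 0%N @^-1` [set n].
  apply/seteqP; split => w; first by move=> /(_ 0%N (leqnn _)).
  by move=> wn i; rewrite leqn0 => /eqP ->.
have mX := measurable_remaining k.
have := measure_split P (mS 0%N) mX (isT : uniq [:: n]).
rewrite big_seq1 setIC -H0 (prob_history_remaining k r0 (leqnn (units n))) // H0 Pn mul1e => ->.
rewrite (_ : P _ = 0%E) ?adde0 //.
have mC := mS 0%N (~` [set n]).
have PC : P (S 0%N @^-1` (~` [set n])) = 0%E.
  rewrite (_ : _ @^-1` _ = ~` (S 0%N @^-1` [set n])) //.
  by rewrite probability_setC ?Pn ?subee //; exact: mS.
apply: subset_measure0 PC => //.
- by apply: measurableI => //; exact: mS.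
- by move=> w [_ /=]; rewrite inE => /eqP.
Qed.

End Process.

Lemma cvg_series_poly (R : realType) (p : {poly R}) (v : R) :
  series (fun k => p`_k * v ^+ k) @ \oo --> p.[v].
Proof.
apply: cvg_near_cst; near=> N.
rewrite /series /= big_mkord (@horner_coef_wide _ N) //.
by near: N; exact: nbhs_infty_ge.
Unshelve. all: by end_near. Qed.

(** * The generating function *)

Lemma pill_product_remove_large_pill (R : realType) (v : R) (r : nat) (n : urn r) (q : R) :
  (0 < r)%N ->
  pill_product v (remove_large_pill n) q =
    (\prod_(1 <= j < r)
       (1 - (-1) ^+ (j - 1) * (1 - v) * q * (ln q ^+ (j - 1) / ((j - 1)`!)%:R))
         ^+ pills n j) *
    (1 - q - (-1) ^+ (r - 1) * (1 - v) * q * (ln q ^+ (r - 1) / ((r - 1)`!)%:R))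
      ^+ (pills n r - 1).
Proof.
case: r n => [//|r] n _.
have poissonE k : (-1) ^+ k * (1 - v) * q * (ln q ^+ k / k`!%:R) = (1 - v) * poisson_ln k q.
  by rewrite /poisson_ln [(- ln q) ^+ _]exprNn; move: (k`!%:R)^-1 => a; ring.
rewrite /pill_product big_ord_recr /= big_add1 big_mkord; congr (_ * _).
  apply: eq_bigr => i _; rewrite tnth_mktuple /= subn1 /= poissonE /pill_factor.
  have -> : (i.+1 == r.+1) = false by have := ltn_ord i; lia.
  by rewrite mul0r subr0 subn0 tnth_pills.
rewrite tnth_mktuple /= eqxx tnth_pills /pill_factor eqxx mul1r.
by rewrite subn1 /= poissonE.
Qed.

Theorem theorem2 (d : measure_display) (T : measurableType d) (R : realType)
    (P : probability T R) (r : nat) (hr : (3 <= r)%N)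
    (n : urn r) (hn : (1 <= pills n r)%N)
    (S : nat -> {RV P >-> urn r}) (hS : pills_urn_process n S) (v : R) :
  cvgn (series (pgf_term P (remaining_single_pills S) v)) /\
  (pgf P (remaining_single_pills S) v)%:E =
    ((pills n r)%:R%:E *
     \int[lebesgue_measure]_(q in `[0%R, 1%R])
       ((\prod_(1 <= j < r)
           (1 - (-1) ^+ (j - 1) * (1 - v) * q * (ln q ^+ (j - 1) / ((j - 1)`!)%:R))
             ^+ pills n j) *
        (1 - q - (-1) ^+ (r - 1) * (1 - v) * q * (ln q ^+ (r - 1) / ((r - 1)`!)%:R))
          ^+ (pills n r - 1))%:E)%E.
Proof.
have r0 : (0 < r)%N by apply: leq_trans hr.
case: hS => S0 S_step.
have mS m (A : set (urn r)) : measurable ((S m : T -> urn r) @^-1` A).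
  rewrite -[X in measurable X]setTI.
  exact: (@measurable_funPT _ _ _ _ (S m)) (measurable_tuple_nat A).
have := cvg_series_poly (p := pgf_poly R (units n) n) (v := v).
rewrite horner_pgf_poly //.
have -> : (fun k => (pgf_poly R (units n) n)`_k * v ^+ k) =
    pgf_term P (remaining_single_pills S) v.
  by apply/funext => k; rewrite (pgf_term_remaining mS S_step v k r0 S0).
move=> cv; split; first by apply/cvg_ex; eexists; exact: cv.
rewrite /pgf (cvg_lim _ cv) // /closed_form gtn_eqF // EFinM EFin_pill_product_integral.
by congr (_ * _)%E; apply: eq_integral => q _; rewrite pill_product_remove_large_pill.
Qed.
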